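(* Let $(X,f)$ be a topological dynamical system, let $Z\subset X$ be an arbitrary subset, let $\varphi:X\to\mathbb{R}$ be a continuous function, and let $g$ be a mistake function. Then $$P_Z(\varphi,g)=P_Z(\varphi),$$ i.e. the Pesin pressure of $\varphi$ on $Z$ with mistake function $g$ equals the (classical) Pesin pressure of $\varphi$ on $Z$.
   Context: A topological dynamical system $(X,f)$ consists of a compact metric space $(X,d)$ and a continuous map $f:X\to X$. Write $\Lambda_n=\{0,1,\dots,n-1\}$, $S_n\varphi(x)=\sum_{j=0}^{n-1}\varphi(f^jx)$, and $d_n(x,y)=\max_{0\le j\le n-1}d(f^jx,f^jy)$ for $n\in\mathbb{N}=\{1,2,\dots\}$. Mistake function: given $\epsilon_0>0$, a function $g:\mathbb{N}\times(0,\epsilon_0]\to[0,\infty)$ is a mistake function if $g(n,\epsilon)\le g(n+1,\epsilon)$ for all $\epsilon\in(0,\epsilon_0]$ and $n\in\mathbb{N}$, and $\lim_{\epsilon\to0}\lim_{n\to\infty}\frac{g(n,\epsilon)}{n}=0$. For $\epsilon>\epsilon_0$ one sets $g(n,\epsilon)=g(n,\epsilon_0)$. Balls: the Bowen ball is $B_n(x,\epsilon)=\{y\in X: d_n(x,y)<\epsilon\}$. The mistake Bowen ball is $$B_n(g;x,\epsilon)=\{y\in X:\exists\,\Lambda\subset\Lambda_n \text{ with } \sharp(\Lambda_n\setminus\Lambda)\le g(n,\epsilon)\text{ and } \max\{d(f^jx,f^jy):j\in\Lambda\}\le\epsilon\}$$ (the condition on the maximum being vacuous if $\Lambda=\emptyset$).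 Classical Pesin pressure: for $Z\subset X$, $\delta>0$, $N\in\mathbb{N}$, let $\mathcal{P}(Z,N,\delta)$ be the collection of all countable (possibly finite) sets $\{(x_i,n_i)\}\subset Z\times\{N,N+1,\dots\}$ such that $Z\subset\bigcup_iB_{n_i}(x_i,\delta)$. For $s\in\mathbb{R}$ put $$m(Z,s,\varphi,N,\delta)=\inf_{\mathcal{P}(Z,N,\delta)}\sum_{(x_i,n_i)}\exp(-n_is+S_{n_i}\varphi(x_i)),\qquad m(Z,s,\varphi,\delta)=\lim_{N\to\infty}m(Z,s,\varphi,N,\delta).$$ The function $s\mapsto m(Z,s,\varphi,\delta)$ is non-increasing and takes the values $\infty$ and $0$ at all but at most one $s$; its critical value is $$P_Z(\varphi,\delta)=\inf\{s\in\mathbb{R}:m(Z,s,\varphi,\delta)=0\}=\sup\{s\in\mathbb{R}:m(Z,s,\varphi,\delta)=\infty\}$$ (an extended real number), and $P_Z(\varphi)=\lim_{\delta\to0}P_Z(\varphi,\delta)$. Pesin pressure with mistake function $g$: let $\mathcal{P}^g(Z,N,\delta)$ be the collection of all countable sets $\{(x_i,n_i)\}\subset Z\times\{N,N+1,\dots\}$ such that $Z\subset\bigcup_iB_{n_i}(g;x_i,\delta)$, and put $$m^g(Z,s,\varphi,N,\delta)=\inf_{\mathcal{P}^g(Z,N,\delta)}\sum_{(x_i,n_i)}\exp(-n_is+S_{n_i}\varphi(x_i)),\qquad m^g(Z,s,\varphi,\delta)=\lim_{N\to\infty}m^g(Z,s,\varphi,N,\delta),$$ $$P_Z(\varphi,\delta,g)=\inf\{s\in\mathbb{R}:m^g(Z,s,\varphi,\delta)=0\}=\sup\{s\in\mathbb{R}:m^g(Z,s,\varphi,\delta)=\infty\},$$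 and $P_Z(\varphi,g)=\lim_{\delta\to0}P_Z(\varphi,\delta,g)$. *)

(* Defs.v *)
From HB Require Import structures.
From mathcomp Require Import all_boot all_order all_algebra.
From mathcomp Require Import all_classical all_reals all_analysis.
Set Implicit Arguments.
Unset Strict Implicit.
Unset Printing Implicit Defensive.
Import Order.TTheory GRing.Theory Num.Theory.
Import numFieldNormedType.Exports.
Local Open Scope classical_set_scope.
Local Open Scope ring_scope.

Section PesinPressure.
Context {R : realType} {X : metricType R}.
Implicit Types (f : X -> X) (phi : X -> R) (Z : set X) (x y : X).
Implicit Types (s eps delta : R) (n N : nat).

Definition birkhoff_sum f phi n x : R := \sum_(j < n) phi (iter j f x).

(* The default value 0 of the maximum is harmless: distances are nonnegative. *)
Definition bowen_dist f n x y : R :=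
  \big[Num.max/0]_(j < n) mdist (iter j f x) (iter j f y).

Definition bowen_ball f n x eps : set X := [set y | bowen_dist f n x y < eps].

(* Only the values [g n eps] with [0 < n] and [0 < eps <= eps0] are meaningful.
   The inner limit is taken in [\bar R] and, as in any iterated limit, is
   required to exist for all sufficiently small [eps > 0]. *)
Definition mistake_function (eps0 : R) (g : nat -> R -> R) : Prop :=
  [/\ forall n eps, (0 < n)%N -> 0 < eps <= eps0 -> 0 <= g n eps,
      forall n eps, (0 < n)%N -> 0 < eps <= eps0 -> g n eps <= g n.+1 eps,
      \forall eps \near 0^'+, cvgn (fun n => (g n eps / n%:R)%:E) &
      limn (fun n => (g n eps / n%:R)%:E) @[eps --> 0^'+] --> 0%:E].

(* The convention g(n, eps) = g(n, eps0) for eps > eps0. *)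
Definition mistake_ext (eps0 : R) (g : nat -> R -> R) n eps : R :=
  g n (Num.min eps eps0).

Definition mistake_ball f (eps0 : R) (g : nat -> R -> R) n x eps : set X :=
  [set y | exists L : {set 'I_n},
     #|~: L|%:R <= mistake_ext eps0 g n eps /\
     forall j : 'I_n, j \in L -> mdist (iter j f x) (iter j f y) <= eps].

(* The construction is carried out for an arbitrary family of balls
   [B n x delta], to be instantiated with Bowen balls and with mistake Bowen
   balls. *)
Implicit Type B : nat -> X -> R -> set X.

Definition pesin_covers B Z N delta : set (set (X * nat)) :=
  [set C | [/\ countable C,
               C `<=` Z `*` [set n | (N <= n)%N] &
               Z `<=` \bigcup_(p in C) B p.2 p.1 delta]].

Definition pesin_inf B f phi Z s N delta : \bar R :=
  ereal_inf [set \esum_(p in C)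
      (expR (- (p.2%:R * s) + birkhoff_sum f phi p.2 p.1))%:E
    | C in pesin_covers B Z N delta].

(* [pesin_inf] is nondecreasing in [N], so this limit exists in [\bar R]. *)
Definition pesin_measure B f phi Z s delta : \bar R :=
  limn (fun N => pesin_inf B f phi Z s N delta).

Definition pressure_at B f phi Z delta : \bar R :=
  ereal_inf [set s%:E | s in [set s | pesin_measure B f phi Z s delta = 0%:E]].

Definition pressure B f phi Z : \bar R :=
  lim (pressure_at B f phi Z delta @[delta --> 0^'+]).

Definition pesin_pressure f phi Z : \bar R :=
  pressure (bowen_ball f) f phi Z.

Definition mistake_pressure_at f (eps0 : R) (g : nat -> R -> R) phi Z delta :
    \bar R :=
  pressure_at (mistake_ball f eps0 g) f phi Z delta.

Definition mistake_pressure f (eps0 : R) (g : nat -> R -> R) phi Z : \bar R :=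
  pressure (mistake_ball f eps0 g) f phi Z.

End PesinPressure.

(* Main.v *)
Require Import Defs.
From HB Require Import structures.
From mathcomp Require Import all_boot all_order all_algebra.
From mathcomp Require Import all_classical all_reals all_analysis.
From mathcomp Require Import lra.
Set Implicit Arguments.
Unset Strict Implicit.
Unset Printing Implicit Defensive.
Import Order.TTheory GRing.Theory Num.Theory.
Import numFieldNormedType.Exports.
Local Open Scope classical_set_scope.
Local Open Scope ring_scope.

(** Bowen balls are mistake balls, so [P_Z(phi, delta, g) <= P_Z(phi, delta)].
    Conversely, fix a finite [eta]-net.  A mistake ball [B_n(g; x, delta)] with
    [delta < eta] is the union of cells indexed by codes, which record for each
    time [j < n] either that [f^j y] is [delta]-close to [f^j x] or, at the
    mistakes, a net point [eta]-close to [f^j y].  Each cell lies in a Bowen ball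
    of radius [2 eta] centred at any of its points.  Since the number of mistakes
    is at most [gam n] with [gam] small, both the exponential growth rate of the
    number of cells and the change of [S_n phi] over them are at most [tau n].
    Hence [P_Z(phi, 2 eta) <= P_Z(phi, delta, g) + tau] for all small [delta]. *)

(** * Sums of nonnegative families *)

(** A section of [h] over the image is injective, so the left sum runs over a part of [D]: repeated
    values of [h] are only dropped. *)
Lemma esum_image_le (R : realType) (T U : choiceType) (h : T -> U) (D : set T)
    (a : U -> \bar R) : (forall u, (0 <= a u)%E) ->
  (\esum_(u in h @` D) a u <= \esum_(t in D) a (h t))%E.
Proof.
move=> a0; have [->|/set0P[t0 _]] := eqVneq D set0.
  by rewrite image_set0 !esum_set0.
have [k kP] : {k : U -> T | forall u, (h @` D) u -> D (k u) /\ h (k u) = u}.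
  exists (fun u => xget t0 [set t | D t /\ h t = u]) => u [t Dt htu].
  by apply: (@xgetI _ t0 [set t | D t /\ h t = u] t).
rewrite (@eq_esum _ _ _ a (fun u => a (h (k u)))); last first.
  by move=> u /kP[_ ->].
rewrite -(esum_image _ k (fun t => a (h t))); last first.
  move=> u v; rewrite !inE => /kP[_ {2}<-] /kP[_ {2}<-] -> //.
rewrite esum_mkcond [leRHS]esum_mkcond; apply: le_esum => t _.
case: ifPn => [|_]; last by case: ifP.
by rewrite inE => -[u /kP[Dku _] <-]; rewrite mem_set.
Qed.

Lemma esum_finType_le (R : realType) (T : finType) (D : set T)
    (a : T -> \bar R) (b : T -> R) :
  (forall t, D t -> (a t <= (b t)%:E)%E) -> (forall t, 0 <= b t) ->
  (\esum_(t in D) a t <= (\sum_t b t)%:E)%E.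
Proof.
move=> ab b0; apply/ereal_supP => _ [F [finF FD] <-].
rewrite fsbig_finite//=.
apply: (@le_trans _ _ (\sum_(t <- finmap.enum_fset (fset_set F)) (b t)%:E)%E).
  rewrite big_seq [leRHS]big_seq; apply: lee_sum => t.
  by rewrite in_fset_set// inE => /FD /ab.
rewrite sumEFin lee_fin big_uniq//=; last exact: finmap.fset_uniq.
rewrite big_mkcond/=; by apply: ler_sum => t _; case: ifP.
Qed.

(** * Consequences of compactness *)

Lemma uniform_oscillation (R : realType) (X : metricType R) (phi : X -> R) (e : R) :
    compact [set: X] -> continuous phi -> 0 < e ->
  \forall delta \near 0^'+,
    forall x y, mdist x y <= delta -> `|phi y - phi x| <= e.
Proof.
move=> /compact_near_coveringP cX cphi e0.
(* Near-covering compactness: a property valid for all pairs close to [x] and [0^'+], for each [x],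
   holds for all points at once when [delta] is small. *)
have H : \forall delta \near (0 : R)^'+, [set: X] `<=` [set x | forall y, mdist x y <= delta -> `|phi y - phi x| <= e].
  apply: cX => x _.
  have /cvgrPdist_lt /(_ (e / 2)) := cphi x.
  rewrite divr_gt0// => /(_ isT) /metricType_numDomainType.nbhs_mdistP[r/= r0 rP].
  exists ([set y | mdist x y < r / 2], [set d | d < r / 2]) => /=.
    split; last by apply: nbhs_right_lt; rewrite divr_gt0.
    apply/metricType_numDomainType.nbhs_mdistP; exists (r / 2) => //=.
    by rewrite divr_gt0.
  move=> [x' d] /= [xx' dr] y x'y.
  have xy : mdist x y < r.
    rewrite (le_lt_trans (metric_triangle x x' y))// (splitr r) ltrD//.
    exact: le_lt_trans dr.
  have xx'r : mdist x x' < r by rewrite (lt_trans xx')// ltr_pdivrMr// ltr_pMr// ltr1n.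
  have := rP _ xy; have := rP _ xx'r => /= /ltW A /ltW B.
  rewrite (le_trans (ler_distD (phi x) _ _))// (splitr e) lerD//.
  by rewrite distrC.
apply: filterS H => d dP x y; exact: dP.
Qed.

Lemma continuous_compact_bounded (R : realType) (X : metricType R) (phi : X -> R) :
    compact [set: X] -> continuous phi ->
  exists2 M, 0 <= M & forall x, `|phi x| <= M.
Proof.
move=> cX cphi.
have : compact (phi @` setT) by apply: continuous_compact => //; exact: continuous_subspaceT.
move=> /compact_bounded[M [_ MP]].
exists (Num.max 0 (M + 1)); first by rewrite le_max lexx.
by move=> x; apply: (MP (Num.max 0 (M + 1))) => //; rewrite lt_max ltrDl ltr01 orbT.
Qed.

Lemma compact_finite_net (R : realType) (X : metricType R) (eta : R) :
    compact [set: X] -> 0 < eta ->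
  exists k (u : 'I_k -> X), forall x, exists i, mdist (u i) x < eta.
Proof.
move=> /compact_near_coveringP cX eta0.
(* Eventually along [F] means for every finite sequence containing some fixed one, so the
   near-covering property yields the net directly. *)
pose F := filter_from [set: seq X] (fun s => [set t : seq X | {subset s <= t}]).
have FF : Filter F.
  apply: filter_from_filter; first by exists [::].
  move=> s t _ _; exists (s ++ t) => // w /= stw; split=> x xst; apply: stw;
  by rewrite mem_cat xst ?orbT.
have [s _ sP] : \forall s \near F, [set: X] `<=` [set x | exists2 u, u \in s & mdist u x < eta].
  apply: cX => x _.
  exists ([set y | mdist x y < eta], [set s : seq X | x \in s]) => /=.
    split; last by exists [:: x] => // s; apply; rewrite mem_head.
    by apply/metricType_numDomainType.nbhs_mdistP; exists eta.
  by move=> [y s] /= [xy xs]; exists x.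
exists (size s), (tnth (in_tuple s)) => x.
have [u us ux] := sP s (fun x h => h) x I.
move: us => /(tnthP (in_tuple s)) [i ui].
by exists i; rewrite -ui.
Qed.

(** * Vanishing measures and density of mistakes *)

(** [pesin_inf] is nonnegative and nondecreasing in [N], so its limit is a supremum and vanishes
    exactly when every term does. *)
Lemma pesin_measure_eq0P (R : realType) (X : metricType R)
    (B : nat -> X -> R -> set X) f phi Z s delta :
  pesin_measure B f phi Z s delta = 0%:E <->
  forall N e, 0 < e -> exists2 C, pesin_covers B Z N delta C &
    (\esum_(p in C)
      (expR (- (p.2%:R * s) + birkhoff_sum f phi p.2 p.1))%:E <= e%:E)%E.
Proof.
pose m N := pesin_inf B f phi Z s N delta.
have m_ge0 N : (0 <= m N)%E.
  apply/ereal_infP => _ [C _ <-]; apply: esum_ge0 => p _.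
  by rewrite lee_fin expR_ge0.
have mnd : nondecreasing_seq m.
  move=> N N' NN'; apply: ereal_inf_le_tmp => _ [C [cC CZ ZC] <-].
  exists C => //; split => //; apply: (subset_trans CZ) => -[x n] [/= Zx N'n].
  by split => //=; exact: leq_trans N'n.
have mE : pesin_measure B f phi Z s delta = ereal_sup (range m).
  apply/cvg_lim; first exact: ereal_hausdorff.
  exact: ereal_nondecreasing_cvgn.
rewrite mE; split=> [m0 N e e0|mP].
  have : (m N < e%:E)%E.
    rewrite (@le_lt_trans _ _ 0%:E) ?lte_fin// -m0.
    by apply: ereal_sup_ubound; exists N.
  by move=> /ereal_inf_lt[_ [C CC <-] /ltW Ce]; exists C.
apply/eqP; rewrite eq_le; apply/andP; split; last first.
  by apply: le_trans (m_ge0 0%N) _; apply: ereal_sup_ubound; exists 0%N.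
apply/ereal_supP => _ [N _ <-]; apply/lee_addgt0Pr => e e0; rewrite add0e.
by have [C CC Ce] := mP N e e0; apply: ge_ereal_inf; exists (\esum_(p in C)
      (expR (- (p.2%:R * s) + birkhoff_sum f phi p.2 p.1))%:E)%E => //; exists C.
Qed.

Lemma near_mistake_ext_le (R : realType) (eps0 : R) g gam : 0 < eps0 ->
    mistake_function eps0 g -> 0 < gam ->
  \forall delta \near 0^'+, \forall n \near \oo,
    mistake_ext eps0 g n delta <= gam * n%:R.
Proof.
move=> eps00 [_ _ gcvg glim] gam0.
have glt : \forall eps \near (0 : R)^'+, (limn (fun n => (g n eps / n%:R)%:E) < gam%:E)%E.
  exact: (glim [set z | (z < gam%:E)%E] (nbhs_open_ereal_lt (f := fun=> gam) gam0)).
near=> d.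
have d0 : d < eps0 by near: d; exact: nbhs_right_lt.
have cd : cvgn (fun n => (g n d / n%:R)%:E) by near: d.
have ld : (limn (fun n => (g n d / n%:R)%:E) < gam%:E)%E by near: d.
rewrite /mistake_ext min_l ?ltW//.
have H : \forall n \near \oo, ((g n d / n%:R)%:E < gam%:E)%E.
  apply: (cd [set z | (z < gam%:E)%E]); apply: open_nbhs_nbhs; split => //.
  exact: open_ereal_lt_ereal.
near=> n.
have n0 : (0 < n)%N by near: n; exact: nbhs_infty_gt.
rewrite -ler_pdivrMr ?ltr0n// -lee_fin ltW//.
by near: n.
Unshelve. all: by end_near. Qed.

(** * Codes and cells *)

(* In a code [c], [Some i] marks a mistake recorded by the net point [u i]. *)
Definition mistakes {T : Type} {n : nat} (c : {ffun 'I_n -> option T}) : nat :=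
  \sum_(j < n) isSome (c j).

Definition code_cell {R : realType} {X : metricType R} (f : X -> X) {T : Type}
    (u : T -> X) (eta delta : R) {n : nat} (x : X)
    (c : {ffun 'I_n -> option T}) : set X :=
  [set y | forall j : 'I_n,
    if c j is Some i then mdist (u i) (iter j f y) < eta
    else mdist (iter j f x) (iter j f y) <= delta].

Lemma mistake_ball_cell (R : realType) (X : metricType R) (f : X -> X)
    (T : Type) (u : T -> X) (eta eps0 : R) g n x delta :
    (forall y, exists i, mdist (u i) y < eta) ->
  forall y, mistake_ball f eps0 g n x delta y ->
  exists2 c : {ffun 'I_n -> option T},
    (mistakes c)%:R <= mistake_ext eps0 g n delta & code_cell f u eta delta x c y.
Proof.
move=> /choice[i iP] y [L [Lg Ly]].
exists [ffun j : 'I_n => if j \in L then None else Some (i (iter j f y))].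
  suff -> : mistakes [ffun j : 'I_n => if j \in L then None
      else Some (i (iter j f y))] = #|~: L| by [].
  rewrite -sum1_card [RHS]big_mkcond; apply: eq_bigr => j _.
  by rewrite ffunE inE; case: ifP.
by move=> j; rewrite ffunE; case: ifPn => [/Ly|_].
Qed.

(** Triangle inequality through [u i] at a mistake and through [iter j f x] at the other times. *)
Lemma cell_bowen_ball (R : realType) (X : metricType R) (f : X -> X)
    (T : Type) (u : T -> X) (eta delta : R) n x (c : {ffun 'I_n -> option T}) y y' :
    0 < eta -> delta < eta -> code_cell f u eta delta x c y ->
    code_cell f u eta delta x c y' ->
  bowen_ball f n y (eta *+ 2) y'.
Proof.
move=> eta0 de cy cy'; rewrite /bowen_ball /bowen_dist/=.
apply: bigmax_lt => [|j _]; first by rewrite pmulrn_lgt0.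
have := cy j; have := cy' j; case: (c j) => [i|] A B; rewrite mulr2n.
  rewrite (le_lt_trans (metric_triangle _ (u i) _))// ltrD// metric_sym//.
rewrite (le_lt_trans (metric_triangle _ (iter j f x) _))// ltrD//.
  by rewrite metric_sym (le_lt_trans B).
exact: le_lt_trans de.
Qed.

(** A time without mistake raises the sum by at most [e], a mistake by at most [M *+ 2]. *)
Lemma cell_birkhoff_sum (R : realType) (X : metricType R) (f : X -> X)
    (phi : X -> R) (T : Type) (u : T -> X) (eta delta e M : R) n x
    (c : {ffun 'I_n -> option T}) y :
    (forall x y, mdist x y <= delta -> `|phi y - phi x| <= e) -> 0 <= e ->
    (forall x, `|phi x| <= M) -> code_cell f u eta delta x c y ->
  birkhoff_sum f phi n y <=
    birkhoff_sum f phi n x + n%:R * e + (M *+ 2) * (mistakes c)%:R.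
Proof.
move=> osc e0 phiM cy.
have -> : n%:R * e = \sum_(j < n) e by rewrite sumr_const card_ord mulr_natl.
rewrite /mistakes natr_sum mulr_sumr -!big_split/=; apply: ler_sum => j _.
rewrite -addrA -lerBlDl; have := cy j; case: (c j) => [i _|/osc]/=.
  rewrite mulr1 mulr2n; apply: ler_wpDl => //.
  rewrite (le_trans (ler_norm _))// (le_trans (ler_normB _ _))// lerD//.
by rewrite mulr0 addr0; apply: le_trans; exact: ler_norm.
Qed.

(** A code is an independent choice at each time, contributing 1 for [None] and [expR (- a)] for
    each element of [T]. *)
Lemma sum_expR_mistakes (R : realType) (T : finType) (n : nat) (a : R) :
  \sum_(c : {ffun 'I_n -> option T}) expR (- a * (mistakes c)%:R) =
    (1 + #|T|%:R * expR (- a)) ^+ n.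
Proof.
transitivity (\sum_(c : {ffun 'I_n -> option T})
    \prod_(j < n) expR (- a * (isSome (c j))%:R)).
  by apply: eq_bigr => c _; rewrite natr_sum mulr_sumr expR_sum.
rewrite -(bigA_distr_bigA (fun _ o => expR (- a * (isSome o)%:R)))/=.
rewrite prodr_const card_ord; congr (_ ^+ _).
rewrite (bigD1 None)//= mulr0 expR0; congr (_ + _).
rewrite (reindex_omap Some id)/=; last by case.
under eq_bigl do rewrite eqxx.
by rewrite mulr1 sumr_const mulr_natl.
Qed.

Lemma expRN_small (R : realType) (k e : R) : 0 <= k -> 0 < e ->
  (* With [a = k / e], the bound [1 + a <= expR a] gives [k <= e + k <= e * expR a]. *)
  exists2 a, 0 <= a & k * expR (- a) <= e.
Proof.
move=> k0 e0; exists (k / e); first by rewrite divr_ge0// ltW.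
rewrite expRN ler_pdivrMr ?expR_gt0//.
apply: (@le_trans _ _ (e * (1 + k / e))); last by rewrite ler_pM2l// expR_ge1Dx.
by rewrite mulrDr mulr1 mulrCA mulfV ?gt_eqF// mulr1 lerDr ltW.
Qed.

(** Centres of a Pesin cover must lie in [Z]: each cell meeting [Z] gets a chosen point of [Z], and
    the default [p.1] is never taken as a default. *)
Definition cell_centers {R : realType} {X : metricType R} (f : X -> X)
    {T : Type} (u : T -> X) (eta delta gam : R) (Z : set X) (p : X * nat) :
    set (X * nat) :=
  [set (xget p.1 (Z `&` code_cell f u eta delta p.1 c), p.2) |
    c in [set c : {ffun 'I_p.2 -> option T} |
      (mistakes c)%:R <= gam * p.2%:R /\
      Z `&` code_cell f u eta delta p.1 c !=set0]].

(** Raising [s] by [tau] gains a factor [expR (- (n * tau))] at length [n]. The three terms bounded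
    by [tau] pay for the oscillation of [phi], for the mistakes and for the number of codes. *)
Lemma esum_cell_centers_le (R : realType) (X : metricType R) (f : X -> X)
    (phi : X -> R) (T : finType) (u : T -> X) (eta delta gam e M a s tau : R) Z p :
    (forall x y, mdist x y <= delta -> `|phi y - phi x| <= e) -> 0 <= e ->
    (forall x, `|phi x| <= M) -> 0 <= M -> 0 <= a ->
    e + (M *+ 2 + a) * gam + #|T|%:R * expR (- a) <= tau ->
  (\esum_(q in cell_centers f u eta delta gam Z p)
     (expR (- (q.2%:R * (s + tau)) + birkhoff_sum f phi q.2 q.1))%:E <=
   (expR (- (p.2%:R * s) + birkhoff_sum f phi p.2 p.1))%:E)%E.
Proof.
case: p => x n osc e0 phiM M0 a0 taule /=.
pose w (q : X * nat) : \bar R :=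
  (expR (- (q.2%:R * (s + tau)) + birkhoff_sum f phi q.2 q.1))%:E.
rewrite /cell_centers /=.
(* Chernoff bound: as [a >= 0], each admissible code satisfies
   [1 <= expR (a * gam * n) * expR (- a * mistakes c)], so the sum may be
   extended with these weights to all codes, where it factorizes over [j]. *)
pose K := expR (- (n%:R * (s + tau)) + birkhoff_sum f phi n x + n%:R * e
  + (M *+ 2 + a) * (gam * n%:R)).
apply: (le_trans (esum_image_le _ _ (a := w) _)) => [q|].
  by rewrite lee_fin expR_ge0.
apply: (le_trans (esum_finType_le
    (b := fun c : {ffun 'I_n -> option T} => K * expR (- a * (mistakes c)%:R)) _ _)).
- move=> c [cgam [y Zy]] /=; rewrite /w/= lee_fin /K -expRD ler_expR -!addrA lerD2l.
  set z := xget _ _.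
  have [_ /(cell_birkhoff_sum osc e0 phiM) Hz] : (Z `&` code_cell f u eta delta x c) z.
    exact: xgetI Zy.
  apply: (le_trans Hz); rewrite -!addrA !lerD2l.
  have C0 : 0 <= M *+ 2 + a by rewrite addr_ge0 ?mulrn_wge0.
  have := ler_wpM2l C0 cgam.
  lra.
- by move=> c; rewrite mulr_ge0 ?expR_ge0.
rewrite -mulr_sumr sum_expR_mistakes lee_fin.
apply: (@le_trans _ _ (K * expR (n%:R * (#|T|%:R * expR (- a))))).
  rewrite ler_pM2l ?expR_gt0// expRM_natl lerXn2r ?nnegrE ?expR_ge0//.
  exact: expR_ge1Dx.
rewrite /K -expRD ler_expR.
have := ler_wpM2l (ler0n R n) taule; lra.
Qed.

(** * Comparison of the two pressures *)

(** Each mistake ball of a cover is replaced by the Bowen balls around its [cell_centers], whose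
    weight at [s + tau] is at most that of the ball at [s]. *)
Lemma pesin_measure_mistake_bowen (R : realType) (X : metricType R) (f : X -> X)
    (phi : X -> R) (eps0 : R) g Z (eta tau : R) :
    compact [set: X] -> continuous phi -> 0 < eps0 ->
    mistake_function eps0 g -> 0 < eta -> 0 < tau ->
  \forall delta \near 0^'+, forall s,
    pesin_measure (mistake_ball f eps0 g) f phi Z s delta = 0%:E ->
    pesin_measure (bowen_ball f) f phi Z (s + tau) (eta *+ 2) = 0%:E.
Proof.
move=> cX cphi eps00 hg eta0 tau0.
have [k [u uP]] := compact_finite_net cX eta0.
have [M M0 phiM] := continuous_compact_bounded cX cphi.
(* One third of [tau] for each loss. The net size fixes [a], then [a] and [M] fix [gam], and the
   radius [d] comes last. *)
have tau3 : 0 < tau / 3 by rewrite divr_gt0.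
have [a a0 aP] := expRN_small (ler0n R k) tau3.
pose gam := tau / 3 / (M *+ 2 + a + 1).
have D0 : 0 < M *+ 2 + a + 1 by rewrite ltr_wpDl// addr_ge0// mulrn_wge0.
have gam0 : 0 < gam by rewrite divr_gt0.
have gamP : (M *+ 2 + a) * gam <= tau / 3.
  rewrite /gam mulrCA; apply: ler_piMr; first exact: ltW.
  by rewrite ler_pdivrMr// mul1r lerDl.
near=> d.
have de : d < eta by near: d; exact: nbhs_right_lt.
have osc : forall x y, mdist x y <= d -> `|phi y - phi x| <= tau / 3.
  by near: d; exact: uniform_oscillation.
have [N0 _ N0P] : \forall n \near \oo, mistake_ext eps0 g n d <= gam * n%:R.
  by near: d; exact: near_mistake_ext_le.
move=> s /pesin_measure_eq0P ms; apply/pesin_measure_eq0P => N e e0.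
(* Lengths at least [N] are required of the new cover; lengths at least [N0] keep the mistakes below
   [gam * n]. *)
have [C [cC CZ ZC] Ce] := ms (maxn N N0) e e0.
pose C' := \bigcup_(p in C) cell_centers f u eta d gam Z p.
pose w (q : X * nat) : \bar R :=
  (expR (- (q.2%:R * (s + tau)) + birkhoff_sum f phi q.2 q.1))%:E.
exists C'.
  split.
  - apply: bigcup_countable => // p _; apply: finite_set_countable.
    exact: finite_image.
  - move=> _ [[x n] /CZ [/= _ Nn] [c [_ [y /(xgetI x)[Zy _]]] <-]].
    by split => //=; apply: leq_trans Nn; rewrite leq_maxl.
  move=> y Zy; have [[x n] Cxn /= xny] := ZC y Zy.
  have [_ /= Nn] := CZ _ Cxn.
  have [c cn cy] := mistake_ball_cell uP xny.
  exists (xget x (Z `&` code_cell f u eta d x c), n).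
    exists (x, n) => //; exists c => //; split; last by exists y.
    by apply: le_trans cn _; apply: N0P; apply: leq_trans Nn; rewrite leq_maxr.
  have [_ cz] : (Z `&` code_cell f u eta d x c) (xget x (Z `&` code_cell f u eta d x c)).
    by apply: (@xgetI _ x _ y).
  exact: cell_bowen_ball cz cy.
apply: le_trans Ce.
(* Seen as the image of a disjoint sum, [C'] has weight at most the iterated sum, even if centres
   from different balls coincide. *)
have -> : C' = snd @` (C `*`` cell_centers f u eta d gam Z).
  apply/seteqP; split=> [q [p Cp pq]|_ [[p q] [/= Cp pq] <-]]; last by exists p.
  by exists (p, q).
apply: (le_trans (@esum_image_le R _ _ snd (C `*`` cell_centers f u eta d gam Z) w _)) => [q|].
  by rewrite lee_fin expR_ge0.
rewrite -(@esum_esum _ _ _ _ _ (fun _ q => w q)); last first.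
  by move=> *; rewrite lee_fin expR_ge0.
apply: le_esum => p _.
apply: (@esum_cell_centers_le _ _ f phi _ u eta d gam (tau / 3) M a) => //.
  exact: ltW.
rewrite card_ord; lra.
Unshelve. all: by end_near. Qed.

Lemma bowen_ball_sub_mistake_ball (R : realType) (X : metricType R) (f : X -> X)
    (eps0 : R) g n x (delta : R) : 0 < eps0 -> mistake_function eps0 g ->
  (0 < n)%N -> 0 < delta ->
  bowen_ball f n x delta `<=` mistake_ball f eps0 g n x delta.
Proof.
move=> eps00 [g0 _ _ _] n0 d0 y xy; exists (finset.setTfor 'I_n); split.
  by rewrite finset.setCT cards0 g0// lt_min d0 eps00 ge_min lexx orbT.
move=> j _; apply: ltW; apply: le_lt_trans xy.
exact: (le_bigmax_cond _ (fun j : 'I_n => mdist (iter j f x) (iter j f y))).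
Qed.

Lemma pressure_at_le (R : realType) (X : metricType R) (B B' : nat -> X -> R -> set X)
    f phi Z (delta delta' : R) :
    (forall n x, (0 < n)%N -> B n x delta `<=` B' n x delta') ->
  (pressure_at B' f phi Z delta' <= pressure_at B f phi Z delta)%E.
Proof.
move=> BB'; apply: ereal_inf_le_tmp => _ [s /pesin_measure_eq0P ms <-].
exists s => //; apply/pesin_measure_eq0P => N e e0.
(* Starting from [N.+1] excludes length 0, where the inclusion of balls is not assumed. *)
have [C [cC CZ ZC] Ce] := ms N.+1 e e0.
exists C => //; split => //.
  by move=> p /CZ[Zp Np]; split => //; exact: ltnW.
move=> y /ZC[p Cp py]; exists p => //; apply: BB' py.
by have [_ /=] := CZ _ Cp; apply: leq_ltn_trans.
Qed.

Lemma cvge_from_below (R : realType) (T : Type) (F : set_system T)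
    (FF : Filter F) (h : T -> \bar R) (l : \bar R) :
    (\forall t \near F, (h t <= l)%E) ->
    (forall r : R, (r%:E < l)%E -> \forall t \near F, (r%:E < h t)%E) ->
  h @ F --> l.
Proof.
case: l => [l||] hl lh.
- move=> A [e /= e0 eA].
  have := lh (l - e); rewrite lte_fin ltrBlDr ltrDl => /(_ e0) {}lh.
  apply: filterS2 hl lh => t; rewrite /=.
  case: (h t) => [r||]//=; rewrite lee_fin lte_fin => rl lr.
  by apply: eA; rewrite /= ger0_norm ?subr_ge0// ltrBlDr addrC -ltrBlDr.
- by apply/cvgeyPgt => r; apply: lh; rewrite ltry.
apply/cvgeNyPle => r; apply: filterS hl => t; rewrite leeNy_eq => /eqP ->.
exact: leNye.
Qed.

Theorem theorem1p8 (R : realType) (X : metricType R) (f : X -> X)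
    (cptX : compact [set: X]) (ctsf : continuous f)
    (Z : set X) (phi : X -> R) (ctsphi : continuous phi)
    (eps0 : R) (eps0_gt0 : 0 < eps0) (g : nat -> R -> R)
    (hg : mistake_function eps0 g) :
  cvg (mistake_pressure_at f eps0 g phi Z delta @[delta --> 0^'+]) /\
  mistake_pressure f eps0 g phi Z = pesin_pressure f phi Z.
Proof.
pose P := pressure_at (bowen_ball f) f phi Z.
pose Q := mistake_pressure_at f eps0 g phi Z.
pose L := ereal_sup (P @` [set` `]0, +oo[]).
(* Bowen balls shrink with [delta], so [P] increases as [delta] decreases to 0. *)
have cvg_bowen : P delta @[delta --> 0^'+] --> L.
  apply: nonincreasing_at_right_cvge => // d d' _ _ dd'.
  apply: pressure_at_le => n x _ y xy; exact: lt_le_trans dd'.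
have QP d : 0 < d -> (Q d <= P d)%E.
  move=> d0; apply: pressure_at_le => n x n0.
  exact: bowen_ball_sub_mistake_ball.
(* A mistake function need not be monotone in the radius, so [Q] is squeezed towards [L] instead of
   being shown monotone. *)
have cvg_mistake : Q delta @[delta --> 0^'+] --> L.
  apply: cvge_from_below.
    near=> d; have d0 : 0 < d by near: d; exact: nbhs_right_gt.
    apply: le_trans (QP d d0) _; apply: ereal_sup_ubound; exists d => //=.
    by rewrite in_itv/= d0.
  move=> r /ereal_sup_gt[_ [eta /= + <-] rP]; rewrite in_itv/= andbT => eta0.
  (* The gap [r' - r] will serve as [tau]; [P eta] may be infinite, hence the cases. *)
  have [r' rr' r'P] : exists2 r', r < r' & (r'%:E < P eta)%E.
    move: rP; case: (P eta) => [p||]//=.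
      rewrite lte_fin => /midf_lt[rm mp]; exists ((r + p) / 2) => //.
    by move=> _; exists (r + 1); rewrite ?ltrDl// ltry.
  (* Halved because passing from cells to Bowen balls doubles the radius. *)
  have eta2 : 0 < eta / 2 by rewrite divr_gt0.
  have tau0 : 0 < r' - r by rewrite subr_gt0.
  have := pesin_measure_mistake_bowen f Z cptX ctsphi eps0_gt0 hg eta2 tau0.
  apply: filterS => d dP; rewrite ltNge; apply/negP => Qr.
  suff : (P eta <= r'%:E)%E by rewrite leNgt r'P.
  have H s : pesin_measure (mistake_ball f eps0 g) f phi Z s d = 0%:E ->
      (P eta <= (s + (r' - r))%:E)%E.
    move=> /dP; rewrite -(mulr_natr (eta / 2)) divfK// => ms.
    by apply: ereal_inf_lbound; exists (s + (r' - r)).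
  (* Taking the infimum over [s] in [H] gives [P eta - (r' - r) <= Q d <= r]. *)
  rewrite -(subrK r r') addrC EFinD -leeBlDr//.
  apply: le_trans Qr; apply/ereal_infP => _ [s ms <-].
  by rewrite leeBlDr// -EFinD; exact: H.
split; first exact: cvgP cvg_mistake.
rewrite /mistake_pressure /pesin_pressure /pressure.
by rewrite (cvg_lim (@ereal_hausdorff R) cvg_mistake) (cvg_lim (@ereal_hausdorff R) cvg_bowen).
Unshelve. all: by end_near. Qed.
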